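(* Let $G\in\mathbb{CR}$ and suppose that, for some Left move index $i$, $G^{i,1}\succeq G^{i,2}$. Let $G'$ be the game with $S^+(G')=S^+(G)$ except that the entry $G^{i,1}$ is replaced by $G^{i,2}$. Then $G=G'$.
   Context: Short cr-games (Cheating Robot games). The set $\mathbb{CR}$ of short cr-games (positions) is defined recursively. A position $G$ consists of a finite list $G(L)$ of $m\ge 0$ Left moves $G(i,\cdot)$, a finite list $G(R)$ of $n\ge 0$ Right moves $G(\cdot,j)$, and, for each $i$ a Left option $G^{i,\cdot}$, for each $j$ a Right option $G^{\cdot,j}$, and for each pair $(i,j)$ a same-round option $G^{i,j}$, all options being previously constructed positions. One writes $G=\{G^L\mid S(G)\mid G^R\}$, where $G^L$, $G^R$ are the lists of Left and Right options and $S(G)$ is the $m\times n$ matrix with entries $G^{i,j}$ ($S(G)=\emptyset$ if $m=0$ or $n=0$). The base case is $0=\{\,\cdot\mid\cdot\mid\cdot\,\}$ (no moves); a dot denotes an empty list. The matrix $S^+(G)$ is $S(G)$ with an extra row and an extra column, both indexed by $\emptyset$ (the player did not play): the extra column has entries $G^{i,\cdot}$, the extra row has entries $G^{\cdot,j}$, and the $(\emptyset,\emptyset)$ entry is the game itself. Thus $G'$ has the same Left options, the same Right options, and the same same-round options as $G$, except that its same-round option in position $(i,1)$ is $G^{i,2}$ instead of $G^{i,1}$. Outcomes. Play proceeds in rounds: from $G$, Left chooses a move $G(i,\cdot)$; then Right, knowing Left's choice, chooses $G(\cdot,j)$; the new position is $G^{i,j}$. If $S(G)=\emptyset$: $o(G)=\mathcal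 L$ (Left wins) if $G(L)\ne\emptyset$; $o(G)=\mathcal R$ (Right wins) if $G(R)\neq\emptyset$; otherwise $o(G)=\mathcal D$ (draw). If $S(G)\ne\emptyset$: $o(G)=\mathcal L$ if Left can force a win, $o(G)=\mathcal R$ if Right can force a win, otherwise $o(G)=\mathcal D$. Outcomes are totally ordered by $\mathcal L>\mathcal D>\mathcal R$. Disjunctive sum. $G+H$ has Left moves $G(i,\cdot)+H$ and $G+H(k,\cdot)$ with Left options $G^{i,\cdot}+H$ and $G+H^{k,\cdot}$; Right moves $G(\cdot,j)+H$ and $G+H(\cdot,l)$ with Right options $G^{\cdot,j}+H$ and $G+H^{\cdot,l}$; and same-round options $G^{i,j}+H$ (both move in $G$), $G+H^{k,l}$ (both move in $H$), $G^{i,\cdot}+H^{\cdot,l}$ (Left in $G$, Right in $H$), $G^{\cdot,j}+H^{k,\cdot}$ (Left in $H$, Right in $G$). Equality and order. For $G,H\in\mathbb{CR}$: $G=H$ if $o(G+X)=o(H+X)$ for all $X\in\mathbb{CR}$; $G\succeq H$ if $o(G+X)\ge o(H+X)$ for all $X\in\mathbb{CR}$. *)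

(* Defs.v *)
From mathcomp Require Import all_boot.
Set Implicit Arguments.
Unset Strict Implicit.
Unset Printing Implicit Defensive.

(* Short cheating-robot games.  [CRGame m n gL gR gS] has m Left moves and n
   Right moves, both numbered from 0: [gL i] is the Left option G^{i,.},
   [gR j] the Right option G^{.,j}, and [gS i j] the same-round option G^{i,j}.
   The matrix [gS] is empty exactly when m = 0 or n = 0. *)
Inductive crgame : Type :=
  CRGame (m n : nat) (gL : 'I_m -> crgame) (gR : 'I_n -> crgame)
         (gS : 'I_m -> 'I_n -> crgame).

Definition nleft (G : crgame) : nat := let: CRGame m _ _ _ _ := G in m.
Definition nright (G : crgame) : nat := let: CRGame _ n _ _ _ := G in n.

Definition lopt (G : crgame) : 'I_(nleft G) -> crgame :=
  let: CRGame _ _ gL _ _ as G0 := G return 'I_(nleft G0) -> crgame in gL.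
Definition ropt (G : crgame) : 'I_(nright G) -> crgame :=
  let: CRGame _ _ _ gR _ as G0 := G return 'I_(nright G0) -> crgame in gR.
Definition sopt (G : crgame) : 'I_(nleft G) -> 'I_(nright G) -> crgame :=
  let: CRGame _ _ _ _ gS as G0 := G
    return 'I_(nleft G0) -> 'I_(nright G0) -> crgame in gS.

(* S^+(G): [None] is the index of the player who did not play. *)
Definition splus (G : crgame) (a : option 'I_(nleft G))
    (b : option 'I_(nright G)) : crgame :=
  match a, b with
  | Some i, Some j => sopt i j
  | Some i, None => lopt i
  | None, Some j => ropt j
  | None, None => G
  end.

Definition set_sopt (G : crgame) (i0 : 'I_(nleft G)) (j0 : 'I_(nright G))
    (K : crgame) : crgame :=
  CRGame (@lopt G) (@ropt G)
    (fun i j => if (i == i0) && (j == j0) then K else sopt i j).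

(* The corner (None, None) of S^+ is the game itself, so it is not compared. *)
Lemma splus_set_sopt (G : crgame) (i0 : 'I_(nleft G)) (j0 : 'I_(nright G))
    (K : crgame) (a : option 'I_(nleft G)) (b : option 'I_(nright G)) :
  (a, b) != (None, None) ->
  splus (G := set_sopt i0 j0 K) a b =
    if (a == Some i0) && (b == Some j0) then K else splus a b.
Proof.
by case: a b => [i|] [j|] //= _; rewrite andbF.
Qed.

(* Left commits to i and Right then answers with j knowing i.  Play ends when
   the same-round matrix is empty, the winner being the player who still has a
   move, if any. *)
Fixpoint left_forces (G : crgame) : bool :=
  let: CRGame m n _ _ gS := G in
  if (m == 0) || (n == 0) then m != 0
  else [exists i, [forall j, left_forces (gS i j)]].

Fixpoint right_forces (G : crgame) : bool :=
  let: CRGame m n _ _ gS := G in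
  if (m == 0) || (n == 0) then n != 0
  else [forall i, [exists j, right_forces (gS i j)]].

Lemma forces_excl (G : crgame) : ~~ (left_forces G && right_forces G).
Proof.
elim: G => m n gL _ gR _ gS IH /=.
case: ifP => [/orP[]/eqP-> //|_]; first by rewrite andbF.
apply/negP => /andP[/existsP[i /forallP lf] /forallP/(_ i)/existsP[j rf]].
by have := IH i j; rewrite lf rf.
Qed.

Inductive outcome : Type := LeftWins | Drawn | RightWins.

Definition outcome_of (G : crgame) : outcome :=
  if left_forces G then LeftWins
  else if right_forces G then RightWins
  else Drawn.

(* LeftWins > Drawn > RightWins *)
Definition outcome_rank (o : outcome) : nat :=
  match o with LeftWins => 2 | Drawn => 1 | RightWins => 0 end.

Definition outcome_ge (o1 o2 : outcome) : bool :=
  outcome_rank o2 <= outcome_rank o1.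

(* Disjunctive sum: in an index of 'I_(m1 + m2), [split] gives [inl] for a move
   in the first component and [inr] for a move in the second. *)
Fixpoint cr_add (G : crgame) {struct G} : crgame -> crgame :=
  fix add_r (H : crgame) {struct H} : crgame :=
    let: CRGame m1 n1 gL gR gS := G in
    let: CRGame m2 n2 hL hR hS := H in
    CRGame
      (fun a : 'I_(m1 + m2) =>
         match split a with
         | inl i => cr_add (gL i) H
         | inr k => add_r (hL k)
         end)
      (fun b : 'I_(n1 + n2) =>
         match split b with
         | inl j => cr_add (gR j) H
         | inr l => add_r (hR l)
         end)
      (fun (a : 'I_(m1 + m2)) (b : 'I_(n1 + n2)) =>
         match split a, split b with
         | inl i, inl j => cr_add (gS i j) H
         | inr k, inr l => add_r (hS k l)
         | inl i, inr l => cr_add (gL i) (hR l)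
         | inr k, inl j => cr_add (gR j) (hL k)
         end).

Definition cr_eq (G H : crgame) : Prop :=
  forall X : crgame, outcome_of (cr_add G X) = outcome_of (cr_add H X).

Definition cr_ge (G H : crgame) : Prop :=
  forall X : crgame,
    outcome_ge (outcome_of (cr_add G X)) (outcome_of (cr_add H X)).

(* Main.v *)
Require Import Defs.
From mathcomp Require Import all_boot.
Set Implicit Arguments.
Unset Strict Implicit.
Unset Printing Implicit Defensive.

(** Right moves second, knowing Left's choice [i], so inside row [i] of the
    matrix Right simply picks the entry that suits Right best.  The entry at
    [j1] is at least as good for Left as the one at [j2], and [j2] is available
    whenever [j1] is: overwriting the former by the latter takes away nothing
    that Right needs and gives Right nothing new.

    Inside a sum with [X] the same comparison has to be made after moves in [X]
    alone, which is an induction on [X]; every other same-round option of the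
    two sums is the same position, because the modification leaves the Left
    and Right options alone.  The lemma [outcome_ge_answers] turns the
    row-by-row comparison into a comparison of outcomes; it is applied once in
    each direction, and the order on outcomes is antisymmetric. *)

(** Left and Right cannot both force a win, so the three-valued comparison
    splits into one implication per player. *)
Lemma outcome_geP (G H : crgame) :
  reflect ((left_forces H -> left_forces G) /\
           (right_forces G -> right_forces H))
          (outcome_ge (outcome_of G) (outcome_of H)).
Proof.
have := forces_excl G; have := forces_excl H.
rewrite /outcome_ge /outcome_of.
case: (left_forces G); case: (right_forces G) => //;
  case: (left_forces H); case: (right_forces H) => //= _ _; constructor;
  by [split | case=> l r; have := l isT | case=> l r; have := r isT].
Qed.

Lemma outcome_ge_refl (o : outcome) : outcome_ge o o.
Proof. exact: leqnn. Qed.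

Lemma outcome_ge_anti (o1 o2 : outcome) :
  outcome_ge o1 o2 -> outcome_ge o2 o1 -> o1 = o2.
Proof. by case: o1; case: o2. Qed.

(** The answer [b'] may depend on Left's move [a] because Right sees it before
    answering.  The same function [b |-> b'] serves both players: it
    translates Right's winning answers in [A], and it shows that a row in
    which Left beats every answer in [B] is one in which Left beats every
    answer in [A]. *)
Lemma outcome_ge_answers (m n : nat) (gL hL : 'I_m -> crgame)
    (gR hR : 'I_n -> crgame) (A B : 'I_m -> 'I_n -> crgame) :
  (forall a b, exists b',
     outcome_ge (outcome_of (A a b)) (outcome_of (B a b'))) ->
  outcome_ge (outcome_of (CRGame gL gR A)) (outcome_of (CRGame hL hR B)).
Proof.
move=> ans; apply/outcome_geP; rewrite /=; case: ifP => // _; split.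
- move=> /existsP[a /forallP winB]; apply/existsP; exists a; apply/forallP => b.
  by have [b' /outcome_geP[+ _]] := ans a b; apply.
- move=> /forallP winA; apply/forallP => a.
  have /existsP[b wb] := winA a; have [b' /outcome_geP[_ +]] := ans a b.
  by move=> /(_ wb) wb'; apply/existsP; exists b'.
Qed.

(** Right keeps every answer, each with a result at least as good for Right as
    before; this holds in every sum, by induction on the other component. *)
Lemma cr_ge_set_sopt (G : crgame) (i : 'I_(nleft G)) (j : 'I_(nright G))
    (K : crgame) :
  cr_ge (sopt i j) K -> cr_ge G (set_sopt i j K).
Proof.
case: G i j => m n gL gR gS /= i j geK.
elim=> m' n' xL _ xR _ xS IH; apply: outcome_ge_answers => a b; exists b.
case: (split a) => [i'|k]; case: (split b) => [j'|l];
  [ | exact: outcome_ge_refl | exact: outcome_ge_refl | exact: IH].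
by case: ifP => [/andP[/eqP-> /eqP->]|_]; [exact: geK | exact: outcome_ge_refl].
Qed.

(** Whatever Right obtains from the copy at [j1], Right could already obtain by
    answering [j2] in the same row. *)
Lemma set_sopt_copy_cr_ge (G : crgame) (i : 'I_(nleft G))
    (j1 j2 : 'I_(nright G)) :
  cr_ge (set_sopt i j1 (sopt i j2)) G.
Proof.
case: G i j1 j2 => m n gL gR gS /= i j1 j2.
elim=> m' n' xL _ xR _ xS IH; apply: outcome_ge_answers => a b.
(* At the overwritten entry Right answers [j2] in the unmodified game, reaching
   the very position that was copied; elsewhere Right repeats the answer. *)
have [/andP[/eqP-> /eqP->]|old] :=
  boolP ((a == lshift m' i) && (b == lshift n' j1)).
  exists (lshift n' j2); rewrite !(unsplitK (inl _)) /= !eqxx.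
  exact: outcome_ge_refl.
exists b; move: old; rewrite -(splitK a) -(splitK b) !unsplitK.
case: (split a) => [i'|k]; case: (split b) => [j'|l] /= old;
  [ | exact: outcome_ge_refl | exact: outcome_ge_refl | exact: IH].
rewrite !eq_lshift in old.
by rewrite (negbTE old); exact: outcome_ge_refl.
Qed.

Theorem theorem7 (G : crgame) (i : 'I_(nleft G)) (j1 j2 : 'I_(nright G))
    (hj1 : j1 = 0 :> nat) (hj2 : j2 = 1 :> nat)
    (hge : cr_ge (sopt i j1) (sopt i j2)) :
  cr_eq G (set_sopt i j1 (sopt i j2)).
Proof.
move=> X; apply: outcome_ge_anti; first exact: cr_ge_set_sopt.
exact: set_sopt_copy_cr_ge.
Qed.
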